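(* The class of central max-point-tolerance graphs (equivalently, of unit max-tolerance graphs) and the class of $50\%$ max-tolerance graphs are not comparable: neither class is contained in the other.
   Context: Graphs are finite and simple; intervals are closed bounded intervals of the real line, and $|I|$ denotes the length of an interval $I$. A graph $G=(V,E)$ is a central max-point-tolerance graph (central MPTG) if one can assign to each $u\in V$ an interval $I_u$ with center (midpoint) $c_u$ such that for distinct $u,v\in V$: $uv\in E$ if and only if $\{c_u,c_v\}\subseteq I_u\cap I_v$. A graph $G=(V,E)$ is a max-tolerance graph if one can assign to each $u\in V$ an interval $I_u$ and a positive real number $t_u$ such that for distinct $u,v\in V$: $uv\in E$ if and only if $|I_u\cap I_v|\ge\max\{t_u,t_v\}$. It is a unit max-tolerance graph if such an assignment exists with all $|I_u|$ equal, and a $50\%$ max-tolerance graph if such an assignment exists with $t_u=|I_u|/2$ for all $u\in V$. *)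

(* Defs.v *)
From HB Require Import structures.
From mathcomp Require Import all_boot all_order all_algebra reals.

Set Implicit Arguments.
Unset Strict Implicit.
Unset Printing Implicit Defensive.
Import Order.TTheory GRing.Theory Num.Theory.
Local Open Scope ring_scope.

Record sgraph := SGraph {
  vertex :> finType;
  edge : rel vertex;
  edge_sym : symmetric edge;
  edge_irrefl : irreflexive edge
}.

(* Degenerate intervals [a, a] are allowed. *)
Record cbitv (R : realType) := CBItv {
  lo : R;
  hi : R;
  lo_le_hi : lo <= hi
}.

Definition itv_of (R : realType) (I : cbitv R) : interval R := `[lo I, hi I].
Coercion itv_of : cbitv >-> interval.

Definition center (R : realType) (I : cbitv R) : R := (lo I + hi I) / 2.

(* The value on unbounded intervals is arbitrary.  [b - a < 0] happens for the
   meet of two disjoint intervals, which is then empty. *)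
Definition len (R : realType) (i : interval R) : R :=
  match i with
  | Interval (BSide _ a) (BSide _ b) => Num.max 0 (b - a)
  | _ => 0
  end.

(* Intersection of intervals as an interval: the meet of [interval R]. *)
Definition inter (R : realType) (i j : interval R) : interval R :=
  (i `&` j)%O.

Definition central_MPTG (R : realType) (G : sgraph) : Prop :=
  exists I : G -> cbitv R,
    forall u v : G, u != v ->
      (edge u v <-> center (I u) \in inter (I u) (I v) /\
                    center (I v) \in inter (I u) (I v)).

Definition max_tolerance_rep (R : realType) (G : sgraph)
    (I : G -> cbitv R) (t : G -> R) : Prop :=
  (forall u : G, 0 < t u) /\
  (forall u v : G, u != v ->
     (edge u v <-> Num.max (t u) (t v) <= len (inter (I u) (I v)))).

Definition unit_max_tolerance (R : realType) (G : sgraph) : Prop :=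
  exists (I : G -> cbitv R) (t : G -> R),
    max_tolerance_rep I t /\ (forall u v : G, len (I u) = len (I v)).

Definition half_max_tolerance (R : realType) (G : sgraph) : Prop :=
  exists (I : G -> cbitv R) (t : G -> R),
    max_tolerance_rep I t /\ (forall u : G, t u = len (I u) / 2).

(* Main.v *)
(** Write [c_u] and [r_u] for the midpoint and the half-length of [I_u].  Then
    [uv] is an edge of a central MPTG iff [|c_u - c_v| <= min(r_u, r_v)], and an
    edge of a 50% max-tolerance graph iff moreover each of [r_u], [r_v] is at
    most twice the other.  Unit intervals of length [L] with tolerances [t_u]
    give [|c_u - c_v| <= min(L - t_u, L - t_v)], whence the equivalence with
    central MPTGs; vertices with [t_u > L] are isolated and are moved away.

    Stars are central MPTGs (leaves at [3^i] with radius [3^i] around a centre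
    at [0]).  In a 50% representation, leaves have bounded position and scale
    relative to the centre, so two of nine leaves fall in a common box and are
    adjacent.

    The octahedron [K_{2,2,2}] is not a central MPTG: the two vertices of an
    antipodal pair avoiding a leftmost and a rightmost vertex lie between two
    common neighbours and hence are adjacent.  It is a 50% max-tolerance graph,
    one antipodal pair being separated by scale instead of distance. *)
Require Import Defs.
From mathcomp Require Import all_boot all_order all_algebra reals.
From mathcomp Require Import lra.

Set Implicit Arguments.
Unset Strict Implicit.
Unset Printing Implicit Defensive.
Import Order.TTheory GRing.Theory Num.Theory.
Local Open Scope ring_scope.

(** * Intersections in terms of midpoints and radii *)

Section Intervals.
Variable R : realType.
Implicit Types (I J : cbitv R) (c r x : R).

Definition radius I : R := (hi I - lo I) / 2.

Lemma radius_ge0 I : 0 <= radius I.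
Proof. by rewrite /radius; have := lo_le_hi I; lra. Qed.

Lemma lenE I : len I = radius I * 2.
Proof.
by rewrite /len /= /radius max_r ?subr_ge0 ?lo_le_hi // divfK ?pnatr_eq0.
Qed.

(** An upper end minus a lower end is a full length if both belong to one interval, and the radius
    sum plus or minus the midpoint difference otherwise. [0 < x] makes the truncation in [len]
    harmless. *)
Lemma le_len_inter I J x : 0 < x ->
  (x <= len (inter I J)) = [&& x <= radius I * 2, x <= radius J * 2 &
    x <= radius I + radius J - `|center I - center J|].
Proof.
move=> x0; rewrite /inter /itv_of /= le_max leNgt x0 /= lerBrDr -lerBrDl.
rewrite leUx !lerBrDl !lexI -[`|_| + x <= _]lerBrDr ler_norml.
rewrite /radius /center.
have := lo_le_hi I; have := lo_le_hi J.
by move=> hI hJ; apply/idP/idP; lra.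
Qed.

Lemma center_inter I J :
  (center I \in inter I J /\ center J \in inter I J) <->
  (`|center I - center J| <= Num.min (radius I) (radius J)).
Proof.
rewrite /inter !in_itvI !in_itv /= le_min !ler_norml /center /radius.
have := lo_le_hi I; have := lo_le_hi J => hI hJ.
by split=> [[]|]; lra.
Qed.

Lemma ball_itv_subproof c r : c - `|r| <= c + `|r|.
Proof. by have := normr_ge0 r; lra. Qed.

(* The norm makes this total: the radius is [r] only when [0 <= r]. *)
Definition ball_itv c r : cbitv R := CBItv (ball_itv_subproof c r).

Lemma center_ball c r : center (ball_itv c r) = c.
Proof. by rewrite /center /=; lra. Qed.

Lemma radius_ball c r : 0 <= r -> radius (ball_itv c r) = r.
Proof. by move=> r0; rewrite /radius /= ger0_norm //; lra. Qed.

End Intervals.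

(** * The three classes in midpoint-radius form *)

Section Representations.
Variables (R : realType) (G : sgraph).

Lemma central_MPTGP : central_MPTG R G <->
  exists c r : G -> R, (forall u, 0 <= r u) /\
    forall u v, u != v -> edge u v = (`|c u - c v| <= Num.min (r u) (r v)).
Proof.
split=> [[I IE]|[c [r [r0 E]]]].
  exists (fun u => center (I u)), (fun u => radius (I u)).
  split=> [u|u v uv]; first exact: radius_ge0.
  by apply/idP/idP => [/(IE _ _ uv)/center_inter|/center_inter/(IE _ _ uv)].
exists (fun u => ball_itv (c u) (r u)) => u v uv.
by rewrite center_inter !center_ball !radius_ball // E.
Qed.

Lemma half_max_toleranceP : half_max_tolerance R G <->
  exists c r : G -> R, (forall u, 0 < r u) /\
    forall u v, u != v -> edge u v = [&& `|c u - c v| <= Num.min (r u) (r v),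
                                         r u <= 2 * r v & r v <= 2 * r u].
Proof.
have lenP (I J : cbitv R) : 0 < radius I -> 0 < radius J ->
    (Num.max (radius I) (radius J) <= len (inter I J)) =
    [&& `|center I - center J| <= Num.min (radius I) (radius J),
        radius I <= 2 * radius J & radius J <= 2 * radius I].
  (* The distance bounds match since [r + s - max(r, s) = min(r, s)]. *)
  move=> I0 J0; rewrite ge_max !le_len_inter // le_min.
  by apply/idP/idP; lra.
split=> [[I [t [[t0 E] tE]]]|[c [r [r0 E]]]].
  have tr u : t u = radius (I u) by rewrite tE lenE mulfK ?pnatr_eq0.
  exists (fun u => center (I u)), (fun u => radius (I u)).
  split=> [u|u v uv]; first by rewrite -tr.
  rewrite -lenP -?tr //.
  by apply/idP/idP => /(E _ _ uv).
exists (fun u => ball_itv (c u) (r u)), r.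
have rad u : radius (ball_itv (c u) (r u)) = r u by rewrite radius_ball // ltW.
split=> [|u]; last by rewrite lenE rad mulfK ?pnatr_eq0.
split=> // u v uv; rewrite E // -{3 4}[r u]rad -{3 4}[r v]rad lenP ?rad //.
by rewrite !center_ball.
Qed.

Lemma unit_max_tolerance_of_central_MPTG :
  central_MPTG R G -> unit_max_tolerance R G.
Proof.
case/central_MPTGP => c [r [r0 E]].
(* A common length above every radius keeps the tolerances [L - r u] positive. *)
pose L := 1 + \sum_u r u.
have rL u : r u < L.
  rewrite /L (bigD1 u) //=.
  have : 0 <= \sum_(i | i != u) r i by apply: sumr_ge0.
  lra.
have L0 : 0 < L by rewrite ltr_pwDl ?ltr01 ?sumr_ge0.
exists (fun u : G => ball_itv (c u) (L / 2)), (fun u => L - r u).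
have rad (u : G) : radius (ball_itv (c u) (L / 2)) = L / 2.
  by rewrite radius_ball // divr_ge0 ?ltW.
split=> [|u v]; last by rewrite !lenE !rad.
split=> [u|u v uv]; first by rewrite subr_gt0.
rewrite ge_max !le_len_inter ?subr_gt0 // !rad !center_ball E // le_min.
have := r0 u; have := r0 v => ru rv.
by split; lra.
Qed.

Lemma central_MPTG_of_unit_max_tolerance :
  unit_max_tolerance R G -> central_MPTG R G.
Proof.
case=> I [t [[t0 E] IL]]; apply/central_MPTGP.
pose L u := radius (I u) * 2.
have LL u v : L u = L v by have := IL u v; rewrite !lenE.
pose M := 1 + \sum_u `|center (I u)|.
have cM u : center (I u) < M.
  rewrite /M (bigD1 u) //=.
  have : 0 <= \sum_(i | i != u) `|center (I i)| by apply: sumr_ge0.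
  have := ler_norm (center (I u)); lra.
(* With radius [0], a moved vertex is adjacent only to vertices at its own midpoint; its midpoint is
   new, being right of all kept ones and indexed by rank. *)
pose c u := if t u <= L u then center (I u) else M + (enum_rank u)%:R.
pose r u := if t u <= L u then L u - t u else 0.
have r0 u : 0 <= r u by rewrite /r; case: ifP => // ?; rewrite subr_ge0.
exists c, r; split=> // u v uv.
have {E}-> : edge u v =
    [&& t u <= L u, t v <= L v & `|center (I u) - center (I v)| <=
                                 Num.min (L u - t u) (L v - t v)].
  have LE : (Num.max (t u) (t v) <= len (inter (I u) (I v))) =
      [&& t u <= L u, t v <= L v & `|center (I u) - center (I v)| <=
                                   Num.min (L u - t u) (L v - t v)].
    rewrite ge_max !le_len_inter // le_min; have := LL u v; rewrite /L => Luv.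
    by apply/idP/idP; lra.
  by rewrite -LE; apply/idP/idP => /(E _ _ uv).
have idx0 (w : G) : 0 <= (enum_rank w)%:R :> R by [].
have idxN : (enum_rank u)%:R != (enum_rank v)%:R :> R.
  by rewrite eqr_nat (inj_eq val_inj) (inj_eq enum_rank_inj).
rewrite /c /r; case: ifP => tu; case: ifP => tv //=.
all: apply/esym/negbTE; rewrite -ltNge gt_min ?normr_gt0 subr_eq0.
- by apply/orP; right; have := cM u; have := idx0 v; case: eqP => //; lra.
- by apply/orP; left; have := cM v; have := idx0 u; case: eqP => //; lra.
- by rewrite (inj_eq (addrI M)) idxN.
Qed.

End Representations.

Section Star.

Definition star_edge n : rel (option 'I_n) :=
  fun u v => (u != v) && ((u == None) || (v == None)).

Lemma star_edge_sym n : symmetric (@star_edge n).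
Proof. by move=> u v; rewrite /star_edge eq_sym orbC. Qed.

Lemma star_edge_irrefl n : irreflexive (@star_edge n).
Proof. by move=> u; rewrite /star_edge eqxx. Qed.

Definition star n := SGraph (@star_edge_sym n) (@star_edge_irrefl n).

Variable R : realType.

Lemma central_MPTG_star n : central_MPTG R (star n).
Proof.
apply/central_MPTGP.
(* Base 2 would fail: consecutive leaves would be at distance exactly the smaller radius. *)
pose p (i : nat) : R := 3 ^+ i.
have p0 i : 0 < p i by rewrite exprn_gt0.
have pn (i : 'I_n) : p i <= p n by rewrite ler_eXn2l ?ltr1n // ltnW.
have sep (i j : nat) : (i < j)%N -> p i < p j - p i.
  move=> ij; have : p i.+1 <= p j by rewrite ler_eXn2l ?ltr1n.
  by have := p0 i; rewrite {2}/p exprS -/(p i); lra.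
exists (fun u : star n => if u is Some i then p i else 0).
exists (fun u : star n => if u is Some i then p i else p n).
split=> [[i|]|]; rewrite ?ltW //.
have nedge i j : (i < j)%N ->
    (`|p i - p j| <= Num.min (p i) (p j)) = false.
  move=> ij; apply/negbTE; rewrite -ltNge gt_min distrC.
  by rewrite (lt_le_trans (sep i j ij)) // ler_norm.
move=> [i|] [j|] //= uv; rewrite /star_edge ?andbF /=.
- have {uv} : nat_of_ord i != j by apply: contraNneq uv => /val_inj ->.
  rewrite neq_ltn => /orP[/nedge-> //|/nedge].
  by rewrite distrC minC => ->.
- by rewrite subr0 gtr0_norm // le_min lexx pn.
- by rewrite sub0r normrN gtr0_norm // le_min lexx pn.
Qed.

Lemma half_max_tolerance_star n : half_max_tolerance R (star n) -> (n <= 8)%N.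
Proof.
case/half_max_toleranceP => c [r [r0 E]].
pose c0 := c None; pose r0' := r None.
(* Leaf radii lie in [[r0'/2, 2r0']] and offsets in [[-r0', r0']]. The bits cut these into two
   ranges of ratio at most 2 and four of length [r0'/2], which is at most any leaf radius. *)
pose box (i : 'I_n) := (r0' <= r (Some i), 0 <= c (Some i) - c0,
                        r0' / 2 <= `|c (Some i) - c0|).
have box_inj : injective box.
  move=> i j [] eqr eqc eqd; apply/eqP; apply: contraT => ij.
  have := E None (Some i) isT; have := E None (Some j) isT.
  have /E : Some i != Some j :> star n by [].
  rewrite /= /star_edge /= ij /= !le_min => /esym/negbT h /esym hj /esym hi.
  case/negP: h; move: hi hj eqr eqc eqd.
  rewrite -/c0 -/r0'; have := r0 (Some i); have := r0 (Some j).
  rewrite !ler_norml; move: (c (Some i)) (c (Some j)) (r (Some i)) (r (Some j)).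
  move=> ci cj ri rj rj0 ri0 hi hj.
  have [?|?] := leP r0' ri; have [?|?] := leP r0' rj => // _;
    case: (ger0P (ci - c0)) => ?; case: (ger0P (cj - c0)) => // ? _;
    by do 2![case: leP => ?] => // _; lra.
have := leq_card _ box_inj; rewrite card_ord !card_prod card_bool; exact.
Qed.

End Star.

Section Octahedron.

(* A vertex is an axis together with a sign. *)
Definition octahedron_edge : rel (option bool * bool) :=
  fun u v => u.1 != v.1.

Lemma octahedron_edge_sym : symmetric octahedron_edge.
Proof. by move=> u v; rewrite /octahedron_edge eq_sym. Qed.

Lemma octahedron_edge_irrefl : irreflexive octahedron_edge.
Proof. by move=> u; rewrite /octahedron_edge eqxx. Qed.

Definition octahedron := SGraph octahedron_edge_sym octahedron_edge_irrefl.

Variable R : realType.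

Lemma not_central_MPTG_octahedron : ~ central_MPTG R octahedron.
Proof.
case/central_MPTGP => c [r [r0 E]].
pose u0 : octahedron := (None, false).
have [x _ xmin] := Order.TotalTheory.arg_minP c (isT : xpredT u0).
have [y _ ymax] := Order.TotalTheory.arg_maxP c (isT : xpredT u0).
have [i ix iy] : exists2 i : option bool, i != x.1 & i != y.1.
  case: (x.1) => [[]|]; case: (y.1) => [[]|];
    by [exists None | exists (Some true) | exists (Some false)].
pose p : octahedron := (i, false); pose q : octahedron := (i, true).
have E' u v : octahedron_edge u v ->
    octahedron_edge u v = (`|c u - c v| <= Num.min (r u) (r v)).
  by move=> uv; apply: E; apply: contraTneq uv => ->;
     rewrite octahedron_edge_irrefl.
have := E' p x ix; have := E' p y iy; have := E' q x ix; have := E' q y iy.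
have /E : p != q by rewrite xpair_eqE andbF.
rewrite /= /octahedron_edge /= ix iy eqxx.
move=> /esym/negbT pq /esym qy /esym qx /esym py /esym px.
case/negP: pq; move: qy qx py px.
have := xmin p isT; have := xmin q isT.
have := ymax p isT; have := ymax q isT => /=.
(* If [p] is left of [q], the edge [qx] bounds their distance by [r q], and the edge [py] by
   [r p]. *)
rewrite !le_min !ler_norml; lra.
Qed.

Lemma half_max_tolerance_octahedron : half_max_tolerance R octahedron.
Proof.
apply/half_max_toleranceP.
(* Midpoint and half-length: the pair on axis [None] has a common midpoint, the
   other two pairs form a 4-cycle represented by distances alone. *)
pose f (u : octahedron) : nat * nat :=
  match u with
  | (None, false) => (10, 11) | (None, true) => (10, 23)
  | (Some false, false) => (0, 20) | (Some false, true) => (16, 13)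
  | (Some true, false) => (4, 13) | (Some true, true) => (20, 20)
  end.
exists (fun u => (f u).1%:R), (fun u => (f u).2%:R).
split=> [[[[]|] []]|[[[]|] []] [[[]|] []] // _]; rewrite ?ltr0n //=.
(* On axis [None], [23 > 2 * 11] excludes the edge, while 13 and 20 are within a factor 2 of both 11
   and 23. *)
all: rewrite /octahedron_edge /= le_min !ler_norml; apply/esym.
all: by apply/idP/idP; lra.
Qed.

End Octahedron.

Theorem theorem4p2 (R : realType) :
  (forall G : sgraph, central_MPTG R G <-> unit_max_tolerance R G) /\
  ~ (forall G : sgraph, central_MPTG R G -> half_max_tolerance R G) /\
  ~ (forall G : sgraph, half_max_tolerance R G -> central_MPTG R G).
Proof.
split=> [G|]; first split.
- exact: unit_max_tolerance_of_central_MPTG.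
- exact: central_MPTG_of_unit_max_tolerance.
split=> h.
- by have := half_max_tolerance_star (h _ (central_MPTG_star R 9)).
- exact: not_central_MPTG_octahedron (h _ (half_max_tolerance_octahedron R)).
Qed.
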